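(* Let $V\in C^2(\mathbb{R}^n)$ be a real function and let $u$ be a positive solution on $\mathbb{R}^n$ of $$\Delta u+2u\log u+V(x)u=0 .$$ (1) If $V$ and $|\nabla V|$ are bounded, then $u$ is bounded, and at every point of $\mathbb{R}^n$ $$u\le \exp\left(\frac13\left\{16n+8\sup_{\mathbb{R}^n}|V|+\frac83\sup_{\mathbb{R}^n}|\nabla V|^2-8V\right\}\right).$$ In particular, when $V\ge 0$ is a constant, this upper bound for $u$ does not depend on $V$. (2) If $V$, $\Delta V$ and $|\nabla V|$ are bounded, then $u$ is bounded, and $$u\le \exp\left(2n+\sup_{\mathbb{R}^n}|\Delta V|+\frac12\sup_{\mathbb{R}^n}|\nabla V|+2\sup_{\mathbb{R}^n}|V|\right).$$
   Context: $\mathbb{R}^n$ carries its standard Euclidean metric. *)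

(* Defs.v *)
From mathcomp Require Import all_boot all_order all_algebra.
From mathcomp Require Import all_classical all_reals all_analysis.
Import Order.TTheory GRing.Theory Num.Theory.
Import numFieldNormedType.Exports.

Set Implicit Arguments.
Unset Strict Implicit.
Unset Printing Implicit Defensive.

Local Open Scope classical_set_scope.
Local Open Scope ring_scope.

Section Euclidean.
Variables (R : realType) (n : nat).
Implicit Types (f V u : 'rV[R]_n -> R) (v x : 'rV[R]_n).

(* The library norm `|v| on 'rV_n is the sup norm; it induces the same topology
   as the Euclidean norm, but lengths of gradients need the latter. *)
Definition enorm v : R := Num.sqrt (\sum_(i < n) v 0 i ^+ 2).

Definition ebase (i : 'I_n) : 'rV[R]_n := delta_mx 0 i.

Definition partial (i : 'I_n) f : 'rV[R]_n -> R := fun x => 'D_(ebase i) f x.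

Definition grad f x : 'rV[R]_n := \row_(i < n) partial i f x.

Definition laplacian f x : R := \sum_(i < n) partial i (partial i f) x.

(* 'D_v takes an unspecified value where the derivative does not exist, so the
   existence of the partial derivatives is required separately. *)
Definition C1 f : Prop :=
  continuous f /\
  forall i, (forall x, derivable f x (ebase i)) /\ continuous (partial i f).

Definition C2 f : Prop := C1 f /\ forall i, C1 (partial i f).

(* A real supremum, meaningful only for f bounded above. *)
Definition supR f : R := sup (range f).

Definition is_positive_solution V u : Prop :=
  [/\ C2 u, (forall x, 0 < u x) &
      forall x, laplacian u x + 2 * u x * ln (u x) + V x * u x = 0].

Definition bound1 V x : R :=
  expR (3^-1 * (16 * n%:R + 8 * supR (fun y => `|V y|)
                + 8 / 3 * supR (fun y => enorm (grad V y) ^+ 2)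
                - 8 * V x)).

Definition bound2 V : R :=
  expR (2 * n%:R + supR (fun y => `|laplacian V y|)
        + 2^-1 * supR (fun y => enorm (grad V y))
        + 2 * supR (fun y => `|V y|)).

End Euclidean.

(* Main.v *)
Require Import Defs.
From mathcomp Require Import all_boot all_order all_algebra.
From mathcomp Require Import all_classical all_reals all_analysis.
From mathcomp Require Import ring lra.
Import Order.TTheory GRing.Theory Num.Theory.
Import numFieldNormedType.Exports.
Local Open Scope classical_set_scope.
Local Open Scope ring_scope.

(** With w = log u the equation becomes Delta w + |grad w|^2 + 2 w + V = 0.
    Put P = |grad w|^2, K = P + 2 w + V = - Delta w, and
    L f = Delta f + 2 <grad w, grad f>.  Bochner's formula together with
    |D^2 w|^2 >= K^2 / n gives
      L P >= 2 K^2 / n - 4 P - 2 <grad w, grad V>   and   L w = 2 P - K.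
    Hence, for b >= 1 and a C^2 function W, the function G = P + 2 b w + b W
    satisfies
      L G >= 2 K^2 / n - 2 b K + (4 b - 4) P - 2 <grad w, grad V>
             + 2 b <grad w, grad W> + b Delta W.
    Where G is maximal the right-hand side is nonpositive.  This is a quadratic
    inequality for K, so it bounds K there, hence G everywhere, and w is bounded
    because 2 b w + b W <= G.

    - If Delta V is bounded, take b = 1 and W = V: then G = K, the two inner
      products cancel and 2 K^2 / n <= 2 K - Delta V
      (log_bound_laplacian).
    - If only grad V is bounded, estimate w at a point c with b = 2 and
      W x = V c - |x - c|^2 / 4.  The term 4 P absorbs the inner products, and
      the mean value inequality V c - V x <= 3/2 sup |grad V|^2 + |x - c|^2 / 6
      turns the bound for G into one for w c that involves V only at c
      (log_bound_gradient).

    Two points need care.  First, u is only C^2, so P is only C^1 and L P has no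
    meaning.  Replacing the partial derivatives of w by difference quotients
    d_i of step h makes sum_i d_i^2 twice differentiable, and L of it can be
    computed exactly, because the equation for w can be subtracted from its
    translate; as h tends to 0 this gives Bochner's inequality up to an error
    that is uniform on compact sets (bochner_approx).

    Second, G need not attain a maximum.  One maximises phi G / eta instead,
    where phi is a cutoff on a large ball and eta = 1 + delta exp (- s w)
    (cutoff_max).  The cutoff produces a term 2 <grad w, grad phi>, which has to
    be controlled although G does not control P where w is very negative; there
    the weight eta contributes a multiple of - s P G.  Where w >= 0, the bound
    P <= K + sup |V| does the work.  Choosing s and delta small, and then the
    radius large, gives approx_max_principle: if G c > 0, the inequality at a
    maximum holds, up to eps (1 + K^2), at some point where G >= G c - eps. *)

Set Implicit Arguments.
Unset Strict Implicit.
Unset Printing Implicit Defensive.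

(** * Derivatives along lines *)

Section Lines.
Variables (R : realType) (U : normedModType R).
Implicit Types (f g : U -> R) (x v : U).

Lemma is_derive_line f x v (t d : R) :
  is_derive (t *: v + x) v f d -> is_derive t 1 (fun h : R => f (h *: v + x)) d.
Proof.
have E : (fun h : R => h^-1 *: ((f \o shift (t *: v + x)) (h *: v) - f (t *: v + x))) =
    (fun h : R => h^-1 *: (((fun k : R => f (k *: v + x)) \o shift t) (h *: (1 : R))
       - f (t *: v + x))).
  by apply/funext => h /=; rewrite [h *: 1]mulr1 scalerDl addrA.
case=> df dE; split; first by move: df; rewrite /derivable E.
by rewrite -dE /derive E.
Qed.

Lemma is_derive_comp_line (phi : R -> R) f x v (a b : R) :
  is_derive x v f a -> is_derive (f x) 1 phi b ->
  is_derive x v (fun y => phi (f y)) (b * a).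
Proof.
move=> fa phib.
have fl : is_derive (0 : R) 1 (fun h : R => f (h *: v + x)) a.
  by apply: is_derive_line; rewrite scale0r add0r.
have pl : is_derive ((fun h : R => f (h *: v + x)) 0) 1 phi b.
  by rewrite scale0r add0r.
have [dl dE] := is_derive1_comp pl fl.
split; first exact: (derivable1P (fun y => phi (f y)) x v).2.
rewrite -dE /derive.
have -> // : (fun h : R => h^-1 *: (((fun y => phi (f y)) \o shift x) (h *: v)
      - phi (f x))) =
  (fun h : R => h^-1 *: (((phi \o (fun k : R => f (k *: v + x))) \o shift 0)
      (h *: (1 : R)) - (phi \o (fun k : R => f (k *: v + x))) 0)).
by apply/funext => h /=; rewrite addr0 scale0r add0r [h *: 1]mulr1.
Qed.

Lemma is_derive_mul f g x v (a b : R) :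
  is_derive x v f a -> is_derive x v g b ->
  is_derive x v (fun y => f y * g y) (f x * b + g x * a).
Proof. exact: is_deriveM. Qed.

Lemma is_derive_add f g x v (a b : R) :
  is_derive x v f a -> is_derive x v g b ->
  is_derive x v (fun y => f y + g y) (a + b).
Proof. exact: is_deriveD. Qed.

Lemma is_derive_const c x v : is_derive x v (fun=> c : R) (0 : R).
Proof. exact: is_derive_cst. Qed.

Lemma is_derive_shiftl f x v z (d : R) :
  is_derive (x + z) v f d -> is_derive x v (fun y => f (y + z)) d.
Proof.
have E : (fun h : R => h^-1 *: ((f \o shift (x + z)) (h *: v) - f (x + z))) =
    (fun h : R => h^-1 *: (((fun y => f (y + z)) \o shift x) (h *: v) - f (x + z))).
  by apply/funext => h /=; rewrite addrA.
case=> df dE; split; first by move: df; rewrite /derivable E.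
by rewrite -dE /derive E.
Qed.

Lemma line_mvt f (df : U -> R) x v (t : R) : 0 <= t ->
  (forall y, is_derive y v f (df y)) ->
  exists2 c, 0 <= c <= t & f (t *: v + x) - f x = df (c *: v + x) * t.
Proof.
move=> t0 fd.
have fl (c : R) : is_derive c 1 (fun h : R => f (h *: v + x)) (df (c *: v + x)).
  exact: is_derive_line.
have fc : {within `[0, t], continuous (fun h : R => f (h *: v + x))}.
  by apply: derivable_within_continuous => c _; case: (fl c).
have [c ct] := MVT_segment t0 (fun c _ => fl c) fc.
by rewrite scale0r add0r subr0 => cE; exists c.
Qed.

(** A positive second derivative would make f1, which vanishes at the maximum,
    positive just after it, so that f would increase. *)
Lemma max_line f (f1 f2 : U -> R) x v :
  (forall y, is_derive y v f (f1 y)) -> is_derive x v f1 (f2 x) ->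
  (\forall h \near (0 : R), f (h *: v + x) <= f x) ->
  f1 x = 0 /\ f2 x <= 0.
Proof.
move=> df df1 fmax.
have /nbhs_ballP [e /= e0 he] := fmax.
have fle t : `|t| < e -> f (t *: v + x) <= f x.
  by move=> te; apply: he; rewrite /ball/= sub0r normrN.
have dl (c : R) : is_derive c 1 (fun h : R => f (h *: v + x)) (f1 (c *: v + x)).
  exact: is_derive_line.
have f10 : f1 x = 0.
  have X : is_derive (0:R) 1 (fun h : R => f (h *: v + x)) 0.
    apply: derive1_at_max (_ : - e <= e) _ _ _; first lra.
    - by move=> t _; case: (dl t).
    - by rewrite in_itv/=; lra.
    - move=> t; rewrite in_itv/= => /andP[te1 te2]; rewrite scale0r add0r.
      by apply: fle; rewrite ltr_norml te1.
  have := dl 0; rewrite scale0r add0r => d0.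
  by rewrite -(@derive_val _ _ _ _ _ _ _ d0) (@derive_val _ _ _ _ _ _ _ X).
split=> //; rewrite leNgt; apply/negP => f2pos.
have dl1 : is_derive (0:R) 1 (fun h : R => f1 (h *: v + x)) (f2 x).
  by apply: is_derive_line; rewrite scale0r add0r.
have : (fun h : R => h^-1 *: (f1 (h *: v + x) - f1 x)) @ 0^' --> f2 x.
  have [/cvg_ex [l hl] hE] := df1.
  by rewrite -hE /derive (cvg_lim _ hl).
move=> /cvgr_gt -/(_ _ f2pos) /=.
move=> /nbhs_ballP [d /= d0 hd].
pose t := Num.min e d / 2.
have m0 : 0 < Num.min e d by rewrite lt_min e0.
have [me md] : Num.min e d <= e /\ Num.min e d <= d by rewrite !ge_min !lexx orbT.
have t0 : 0 < t by rewrite /t; lra.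
have te : t < e by rewrite /t; lra.
have td : t < d by rewrite /t; lra.
have pos c : 0 < c -> c <= t -> 0 < f1 (c *: v + x).
  move=> c0 ct; have := hd c _ _; rewrite f10 subr0 [_ *: _]mulrC pmulr_lgt0 ?invr_gt0 //.
  apply; last by rewrite gt_eqF.
  by rewrite /ball/= sub0r normrN gtr0_norm //; lra.
have fc : {within `[0, t], continuous (fun h : R => f (h *: v + x))}.
  by apply: derivable_within_continuous => c _; case: (dl c).
have [c] := MVT t0 (fun c _ => dl c) fc.
rewrite in_itv/= scale0r add0r subr0 => /andP[c0 ct] cE.
have := fle t; rewrite gtr0_norm // => /(_ te).
have := pos c c0 (ltW ct) => p1; have := mulr_gt0 p1 t0; rewrite -cE; lra.
Qed.
End Lines.

(** * Second-order jets in a coordinate direction *)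

Section Jets.
Variables (R : realType) (n : nat).
Implicit Types (f g : 'rV[R]_n -> R) (x z : 'rV[R]_n) (i j : 'I_n).

(** Only pure second derivatives enter the Laplacian and the maximum principle,
    so f is tracked together with its first two derivatives along one axis;
    mixed derivatives never occur. *)
Definition jet2 i f (f1 f2 : 'rV[R]_n -> R) : Prop :=
  (forall x, is_derive x (ebase R i) f (f1 x)) /\
  (forall x, is_derive x (ebase R i) f1 (f2 x)).

Lemma jet2_C2 i f : C2 f -> jet2 i f (partial i f) (partial i (partial i f)).
Proof.
move=> [[_ h1] h2]; split=> x; apply: derivableP; first exact: (h1 i).1.
by have [_ /(_ i)[]] := h2 i.
Qed.

Lemma jet2_ext i f f1 f2 g g1 g2 : jet2 i f f1 f2 ->
  f =1 g -> f1 =1 g1 -> f2 =1 g2 -> jet2 i g g1 g2.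
Proof. by move=> h /funext <- /funext <- /funext <-. Qed.

Lemma jet2D i f f1 f2 g g1 g2 : jet2 i f f1 f2 -> jet2 i g g1 g2 ->
  jet2 i (fun x => f x + g x) (fun x => f1 x + g1 x) (fun x => f2 x + g2 x).
Proof. by move=> [a b] [c d]; split=> x; apply: is_derive_add. Qed.

Lemma jet2M i f f1 f2 g g1 g2 : jet2 i f f1 f2 -> jet2 i g g1 g2 ->
  jet2 i (fun x => f x * g x) (fun x => f x * g1 x + g x * f1 x)
    (fun x => f x * g2 x + 2 * (f1 x * g1 x) + g x * f2 x).
Proof.
move=> [a b] [c d]; split=> x; first exact: is_derive_mul.
rewrite (_ : _ + _ = (f x * g2 x + g1 x * f1 x) + (g x * f2 x + f1 x * g1 x)).
  by apply: is_derive_add; apply: is_derive_mul.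
by ring.
Qed.

Lemma jet2_const i (c : R) : jet2 i (fun=> c) (fun=> 0) (fun=> 0).
Proof. by split=> x; apply: is_derive_const. Qed.

Lemma jet2Z i (c : R) f f1 f2 : jet2 i f f1 f2 ->
  jet2 i (fun x => c * f x) (fun x => c * f1 x) (fun x => c * f2 x).
Proof.
by move=> h; apply: jet2_ext (jet2M (jet2_const i c) h) _ _ _ => x //=; ring.
Qed.

Lemma jet2_sum i (m : nat) (f f1 f2 : 'I_m -> 'rV[R]_n -> R) :
  (forall k, jet2 i (f k) (f1 k) (f2 k)) ->
  jet2 i (fun x => \sum_k f k x) (fun x => \sum_k f1 k x)
    (fun x => \sum_k f2 k x).
Proof.
move=> h; split=> x.
- have -> : (fun x => \sum_k f k x) = \sum_k f k.
    by apply/funext => y; rewrite fct_sumE.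
  by apply: is_derive_sum => k; have [] := h k.
- have -> : (fun x => \sum_k f1 k x) = \sum_k f1 k.
    by apply/funext => y; rewrite fct_sumE.
  by apply: is_derive_sum => k; have [] := h k.
Qed.

Lemma jet2_exp i f f1 f2 : jet2 i f f1 f2 ->
  jet2 i (fun x => expR (f x)) (fun x => expR (f x) * f1 x)
    (fun x => expR (f x) * (f1 x ^+ 2 + f2 x)).
Proof.
move=> [a b].
have e x : is_derive x (ebase R i) (fun x => expR (f x)) (expR (f x) * f1 x).
  exact: is_derive_comp_line.
split=> // x.
rewrite (_ : _ * _ = expR (f x) * f2 x + f1 x * (expR (f x) * f1 x)).
  exact: is_derive_mul.
by ring.
Qed.

Lemma jet2_ln i f f1 f2 : (forall x, 0 < f x) -> jet2 i f f1 f2 ->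
  jet2 i (fun x => ln (f x)) (fun x => (f x)^-1 * f1 x)
    (fun x => (f x)^-1 * f2 x - ((f x)^-1 * f1 x) ^+ 2).
Proof.
move=> f0 [a b]; split=> x.
  by apply: is_derive_comp_line => //; apply: is_derive1_ln.
have iv : is_derive x (ebase R i) (fun x => (f x)^-1) (- (f x) ^- 2 * f1 x).
  apply: is_derive_comp_line => //.
  have := @is_deriveV R id (f x) 1 1; rewrite gt_eqF // => /(_ isT).
  by rewrite /GRing.scale /= mulr1; apply; apply: is_derive_id.
rewrite (_ : _ - _ = (f x)^-1 * f2 x + f1 x * (- (f x) ^- 2 * f1 x)).
  exact: is_derive_mul.
by rewrite exprMn -exprVn; ring.
Qed.

Lemma jet2_shift i f f1 f2 z : jet2 i f f1 f2 ->
  jet2 i (fun x => f (x + z)) (fun x => f1 (x + z)) (fun x => f2 (x + z)).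
Proof. by move=> [a b]; split=> x; apply: is_derive_shiftl. Qed.

Lemma jet2_coord i j :
  jet2 i (fun x => x 0 j) (fun=> (i == j)%:R) (fun=> 0).
Proof.
split=> x; last exact: is_derive_const.
have E h : h != 0 -> h^-1 *: (((fun y : 'rV[R]_n => y 0 j) \o shift x)
    (h *: ebase R i) - x 0 j) = (i == j)%:R.
  by move=> h0; rewrite /= !mxE addrK /GRing.scale /= mulKf // eq_sym.
have cv : (fun h : R => h^-1 *: (((fun y : 'rV[R]_n => y 0 j) \o shift x)
    (h *: ebase R i) - x 0 j)) @ 0^' --> ((i == j)%:R : R).
  apply: (@cvg_trans _ ((fun=> (i == j)%:R : R) @ (0 : R)^')); last exact: cvg_cst.
  apply: near_eq_cvg.
  apply: filterS (nbhs_dnbhs_neq (0 : R)) => h h0; exact/esym/E.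
by split; [exact: cvgP cv | apply: cvg_lim cv].
Qed.

Lemma jet2_max i f f1 f2 x : jet2 i f f1 f2 ->
  (\forall y \near x, f y <= f x) -> f1 x = 0 /\ f2 x <= 0.
Proof.
move=> [a b] fx; apply: max_line a (b x) _.
have : (fun h : R => h *: ebase R i + x) @ (0 : R) --> 0 *: ebase R i + x.
  by apply: cvgD; [apply: cvgZr_tmp; exact: cvg_id | exact: cvg_cst].
by rewrite scale0r add0r => /(_ _ fx).
Qed.

End Jets.

(** * Bochner's inequality through difference quotients *)

Section Bochner.
Variables (R : realType) (n : nat).
Implicit Types (f g : 'rV[R]_n -> R) (x z : 'rV[R]_n) (i j : 'I_n).

Definition pureC2 f (f1 f2 : 'I_n -> 'rV[R]_n -> R) : Prop :=
  [/\ continuous f, forall i, continuous (f1 i), forall i, continuous (f2 i)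
    & forall i, jet2 i f (f1 i) (f2 i)].

Definition dquot (h : R) i f x : R := h^-1 * (f (x + h *: ebase R i) - f x).

Lemma jet2_dquot h i j f f1 f2 : jet2 j f f1 f2 ->
  jet2 j (dquot h i f) (dquot h i f1) (dquot h i f2).
Proof.
move=> hf; have hs := jet2_shift (h *: ebase R i) hf.
have := jet2Z h^-1 (jet2D hs (jet2Z (-1) hf)).
by move=> /jet2_ext; apply=> x; rewrite /dquot mulN1r.
Qed.

(** The convergence is joint in the base point and the step; a compactness
    argument upgrades it to uniform convergence on compact sets. *)
Lemma dquot_cvg i f f1 x : (forall y, is_derive y (ebase R i) f (f1 y)) ->
  continuous f1 ->
  (fun z : 'rV[R]_n * R => dquot z.2 i f z.1) @ filter_prod (nbhs x) (0 : R)^'+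
    --> f1 x.
Proof.
move=> df cf; apply/cvgrPdist_lt => e e0.
have ct : (fun z : 'rV[R]_n * R => z.2 *: ebase R i + z.1) @
    filter_prod (nbhs x) (nbhs (0 : R)) --> x.
  have : (fun z : 'rV[R]_n * R => z.2 *: ebase R i + z.1) @
    filter_prod (nbhs x) (nbhs (0 : R)) --> 0 *: ebase R i + x.
    by apply: cvgD; [apply: cvgZr_tmp; exact: cvg_snd | exact: cvg_fst].
  by rewrite scale0r add0r.
have cft := cvg_comp _ _ ct (cf x).
move/cvgrPdist_lt : cft => /(_ _ e0) [[A B] /= [Ax B0] AB].
have [d /= d0 Bd] := (nbhs_ballP _ _).1 B0.
exists (A, [set h : R | 0 < h < d]).
  split=> //=; exists d => //= h; rewrite /ball/= sub0r normrN => hd h0.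
  by rewrite /= h0 /=; apply: le_lt_trans hd; exact: ler_norm.
case=> y h /= [Ay /andP[h0 hd]].
have [c /andP[c0 ch]] := line_mvt y (ltW h0) df.
rewrite /dquot [_ *: _ + y]addrC => ->; rewrite mulrCA mulVf ?gt_eqF // mulr1.
apply: (AB (y, c)); split=> //=; apply: Bd.
by rewrite /ball/= sub0r normrN ger0_norm //; lra.
Qed.

Lemma cvg_sumR (I : Type) (F : set_system I) {FF : Filter F} (m : nat)
  (f : 'I_m -> I -> R) (l : 'I_m -> R) :
  (forall k, f k t @[t --> F] --> l k) ->
  (\sum_k f k t) @[t --> F] --> \sum_k l k.
Proof. by move=> h; apply: cvg_big => //; exact: add_continuous. Qed.

(** The finite-difference form of
    L |grad w|^2 = 2 |D^2 w|^2 - 4 |grad w|^2 - 2 <grad w, grad V>.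
    For d_i = dquot h i w the equation at x and at x + h e_i gives
    L d_i = - h |grad d_i|^2 - 2 d_i - dquot h i V, and p = sum_i d_i^2 is the
    required approximation of |grad w|^2 when h is small. *)
Lemma bochner_approx w (w1 w2 : 'I_n -> 'rV[R]_n -> R) V
  (V1 : 'I_n -> 'rV[R]_n -> R) (A : set 'rV[R]_n) (eps : R) :
  pureC2 w w1 w2 ->
  (forall i x, is_derive x (ebase R i) V (V1 i x)) ->
  (forall i, continuous (V1 i)) ->
  (forall x, \sum_i (w2 i x + w1 i x ^+ 2) + 2 * w x + V x = 0) ->
  compact A -> 0 < eps ->
  exists p p1 p2, [/\ continuous p, (forall i, jet2 i p (p1 i) (p2 i)) &
    forall x, A x -> `|p x - \sum_i w1 i x ^+ 2| <= eps /\
      \sum_i (2 * w2 i x ^+ 2 - 4 * w1 i x ^+ 2 - 2 * (w1 i x * V1 i x)) - eps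
      <= \sum_i (p2 i x + 2 * (w1 i x * p1 i x))].
Proof.
move=> [cw cw1 cw2 jw] dV cV1 heq cA e0.
pose d h i := dquot h i w.
pose p h x := \sum_i d h i x * d h i x.
pose p1 h j x := \sum_i (d h i x * dquot h i (w1 j) x + d h i x * dquot h i (w1 j) x).
pose p2 h j x := \sum_i (d h i x * dquot h i (w2 j) x
   + 2 * (dquot h i (w1 j) x * dquot h i (w1 j) x) + d h i x * dquot h i (w2 j) x).
have jp h j : jet2 j (p h) (p1 h j) (p2 h j).
  by apply: jet2_sum => i; apply: jet2M; apply: jet2_dquot.
(* Exact for every step: the increment of |grad w|^2 over h e_i is
   2 h <grad w, grad d_i> + h^2 |grad d_i|^2. *)
have Lp h x : h != 0 -> \sum_j (p2 h j x + 2 * (w1 j x * p1 h j x)) =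
    \sum_i (2 * (1 - h * d h i x) * (\sum_j dquot h i (w1 j) x ^+ 2)
       - 4 * d h i x ^+ 2 - 2 * (d h i x * dquot h i V x)).
  move=> h0.
  transitivity (\sum_i \sum_j (2 * dquot h i (w1 j) x ^+ 2 + 2 * d h i x *
     (dquot h i (w2 j) x + 2 * (w1 j x * dquot h i (w1 j) x)))).
    rewrite [RHS]exchange_big; apply: eq_bigr => j _ /=.
    rewrite /p2 /p1 !mulr_sumr -big_split /=; apply: eq_bigr => i _; ring.
  apply: eq_bigr => i _; rewrite big_split /= -!mulr_sumr.
  have -> : \sum_j (dquot h i (w2 j) x + 2 * (w1 j x * dquot h i (w1 j) x)) =
     - h * (\sum_j dquot h i (w1 j) x ^+ 2) - 2 * d h i x - dquot h i V x.
    pose x' := x + h *: ebase R i.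
    have -> : \sum_j (dquot h i (w2 j) x + 2 * (w1 j x * dquot h i (w1 j) x)) =
      h^-1 * (\sum_j (w2 j x' + w1 j x' ^+ 2) - \sum_j (w2 j x + w1 j x ^+ 2))
      - h * (\sum_j dquot h i (w1 j) x ^+ 2).
      rewrite -sumrB !mulr_sumr -sumrB; apply: eq_bigr => j _.
      by rewrite /dquot -/x'; field.
    have E y : \sum_j (w2 j y + w1 j y ^+ 2) = - (2 * w y + V y).
      by have := heq y; lra.
    by rewrite !E /d /dquot -/x'; field.
  ring.
pose P x := \sum_i w1 i x ^+ 2.
pose T x := \sum_i (2 * w2 i x ^+ 2 - 4 * w1 i x ^+ 2 - 2 * (w1 i x * V1 i x)).
(* |grad d_i|^2 is bounded below by its i-th term, whose limit is a pure
   second derivative; this needs the factor 1 - h d_i to be nonnegative. *)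
pose l h x := \sum_i (2 * (1 - h * d h i x) * (dquot h i (w1 i) x ^+ 2)
       - 4 * d h i x ^+ 2 - 2 * (d h i x * dquot h i V x)).
have ldle h x : h != 0 -> \sum_i (h * d h i x) ^+ 2 < 1 ->
   l h x <= \sum_j (p2 h j x + 2 * (w1 j x * p1 h j x)).
  move=> h0 hd; rewrite Lp //; apply: ler_sum => i _.
  rewrite !lerD2r; apply: ler_wpM2l; last first.
    by rewrite (bigD1 i) //= lerDl; apply: sumr_ge0 => j _; exact: sqr_ge0.
  have : (h * d h i x) ^+ 2 < 1.
    apply: le_lt_trans hd; rewrite (bigD1 i) //= lerDl.
    by apply: sumr_ge0 => j _; exact: sqr_ge0.
  by nra.
have cp h : continuous (p h).
  move=> x; apply: (@cvg_sumR _ (nbhs x)) => i.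
  have cs : (fun y : 'rV[R]_n => y + h *: ebase R i) @ nbhs x --> x + h *: ebase R i.
    by apply: (@cvgD _ _ _ (nbhs x)); [exact: cvg_id | exact: cvg_cst].
  have cd : (fun y => h^-1 * (w (y + h *: ebase R i) - w y)) @ nbhs x --> d h i x.
    apply: (@cvgM _ _ (nbhs x)); first exact: cvg_cst.
    apply: (@cvgB _ _ _ (nbhs x)); last exact: cw.
    exact: (cvg_comp _ _ cs (cw _)).
  exact: (cvgM cd cd).
have near1 x : A x -> \forall x' \near x & h \near (0 : R)^'+,
   [/\ h != 0, \sum_i (h * d h i x') ^+ 2 < 1, `|p h x' - P x'| <= eps &
     T x' - eps <= l h x'].
  move=> _.
  pose F : set_system ('rV[R]_n * R) := filter_prod (nbhs x) (0 : R)^'+.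
  have FF : Filter F by apply: filter_prod_filter.
  have ch : z.2 @[z --> F] --> (0 : R).
    apply: cvg_trans; first exact: cvg_snd.
    exact: cvg_at_right_filter cvg_id.
  have cd i : d z.2 i z.1 @[z --> F] --> w1 i x.
    by apply: dquot_cvg => //; have [] := jw i.
  have cd1 i : dquot z.2 i (w1 i) z.1 @[z --> F] --> w2 i x.
    by apply: dquot_cvg => //; have [] := jw i.
  have cdV i : dquot z.2 i V z.1 @[z --> F] --> V1 i x by apply: dquot_cvg.
  have cc g : continuous g -> g z.1 @[z --> F] --> g x.
    by move=> cg; have c := cvg_comp _ _ (@cvg_fst _ _ (nbhs x) _ _) (cg x); exact: c.
  have c1 : \sum_i (z.2 * d z.2 i z.1) ^+ 2 @[z --> F] --> \sum_(i < n) (0 * w1 i x) ^+ 2.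
    by apply: cvg_sumR => i; apply: cvgM; apply: cvgM.
  have c2 : p z.2 z.1 - P z.1 @[z --> F] --> \sum_i (w1 i x * w1 i x) - \sum_i (w1 i x * w1 i x).
    apply: cvgB; apply: cvg_sumR => i; apply: cvgM => //; exact: cc.
  have c3 : l z.2 z.1 - T z.1 @[z --> F] -->
     \sum_i (2 * (1 - 0 * w1 i x) * (w2 i x * w2 i x) - 4 * (w1 i x * w1 i x)
         - 2 * (w1 i x * V1 i x)) -
     \sum_i (2 * (w2 i x * w2 i x) - 4 * (w1 i x * w1 i x) - 2 * (w1 i x * V1 i x)).
    apply: cvgB; apply: cvg_sumR => i; apply: cvgB; try apply: cvgB;
      (apply: cvgM; [|apply: cvgM]) => //; try exact: cvg_cst; try exact: cc.
    apply: cvgM; first exact: cvg_cst.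
    by apply: cvgB; [exact: cvg_cst | apply: cvgM].
  have {}c1 : \forall z \near F, \sum_i (z.2 * d z.2 i z.1) ^+ 2 < 1.
    apply: (cvgr_lt _ c1); rewrite big1 ?ltr01 // => i _.
    by rewrite mul0r expr0n.
  have {}c2 : \forall z \near F, `|p z.2 z.1 - P z.1| <= eps.
    move: c2; rewrite subrr => /cvgr0_norm_le; exact.
  have {}c3 : \forall z \near F, - eps < l z.2 z.1 - T z.1.
    apply: (cvgr_gt _ c3); rewrite (_ : _ - _ = 0) ?oppr_lt0 //.
    by rewrite -sumrB big1 // => i _; ring.
  have {}ch : \forall z \near F, z.2 != 0.
    exists (setT, [set h : R | h != 0]); last by case=> ? ? [].
    split; first exact: filterT.
    by exists 1 => //= h _ h0; rewrite gt_eqF.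
  have : \forall z \near F, [/\ z.2 != 0, \sum_i (z.2 * d z.2 i z.1) ^+ 2 < 1,
      `|p z.2 z.1 - P z.1| <= eps & T z.1 - eps <= l z.2 z.1].
    near=> z; split; [by near: z..|].
    have : - eps < l z.2 z.1 - T z.1 by near: z.
    by lra.
  by [].
have := (compact_near_coveringP A).1 cA _ _ (fun h x' =>
   [/\ h != 0, \sum_i (h * d h i x') ^+ 2 < 1, `|p h x' - P x'| <= eps &
     T x' - eps <= l h x']) (at_right_proper_filter (0 : R)) near1.
move=> /filter_ex [h hh].
exists (p h), (p1 h), (p2 h); split=> // x /hh [h0 hd hp hl]; split=> //.
exact: le_trans hl (ldle _ _ h0 hd).
Unshelve. all: by end_near. Qed.

End Bochner.

(** * Maximum of a localised and weighted function *)

Section Local.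
Variables (R : realType) (n : nat).
Implicit Types (f g : 'rV[R]_n -> R) (x z c : 'rV[R]_n) (i j : 'I_n).

Definition sqdist c x : R := \sum_j (x 0 j - c 0 j) ^+ 2.

Lemma sqdist_ge0 c x : 0 <= sqdist c x.
Proof. by apply: sumr_ge0 => j _; exact: sqr_ge0. Qed.

Lemma sqdistxx c : sqdist c c = 0.
Proof. by rewrite /sqdist big1 // => j _; rewrite subrr expr0n. Qed.

Lemma jet2_sqdist i c :
  jet2 i (sqdist c) (fun x => 2 * (x 0 i - c 0 i)) (fun=> 2).
Proof.
have h j : jet2 i (fun x => x 0 j - c 0 j) (fun=> (i == j)%:R) (fun=> 0).
  by apply: jet2_ext (jet2D (jet2_coord R i j) (jet2_const i (- c 0 j))) _ _ _
    => x //=; rewrite addr0.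
apply: jet2_ext (jet2_sum (fun j => jet2M (h j) (h j))) _ _ _ => x //=.
- rewrite (bigD1 i) //= eqxx mulr1n big1 ?addr0; first by ring.
  by move=> j; rewrite eq_sym => /negPf ->; rewrite mulr0n !mulr0 addr0.
- rewrite (bigD1 i) //= eqxx mulr1n big1 ?addr0; first by ring.
  by move=> j; rewrite eq_sym => /negPf ->; rewrite mulr0n !mulr0 !addr0.
Qed.

Lemma continuous_sqdist c : continuous (sqdist c).
Proof.
move=> x; apply: (@cvg_sumR _ _ (nbhs x)) => j.
have h : (fun y : 'rV[R]_n => y 0 j - c 0 j) @ nbhs x --> x 0 j - c 0 j.
  by apply: (@cvgB _ _ _ (nbhs x)); [exact: coord_continuous | exact: cvg_cst].
exact: (cvgM h h).
Qed.

Lemma compact_ball_sqdist c (a : R) : 0 < a -> compact [set x | a ^+ 2 * sqdist c x <= 1].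
Proof.
move=> a0.
apply: (@subclosed_compact _ _ [set v : 'rV[R]_n | forall i,
   v ord0 i \in `[c 0 i - a^-1, c 0 i + a^-1]]).
- have cl : closed ((fun x => a ^+ 2 * sqdist c x) @^-1` [set y : R | y <= 1]).
    apply: closed_comp; last exact: closed_le.
    move=> x _; apply: (@cvgM _ _ (nbhs x)); first exact: cvg_cst.
    exact: continuous_sqdist.
  exact: cl.
- apply: (@rV_compact _ _ (fun i => `[c 0 i - a^-1, c 0 i + a^-1]%classic)).
  by move=> i; exact: segment_compact.
- move=> x /= hx i.
  have h : (a * (x 0 i - c 0 i)) ^+ 2 <= 1.
    apply: le_trans hx; rewrite exprMn ler_wpM2l ?sqr_ge0 //.
    rewrite /sqdist (bigD1 i) //= lerDl; apply: sumr_ge0 => j _; exact: sqr_ge0.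
  have aV : a * a^-1 = 1 by rewrite mulfV ?gt_eqF.
  have aV0 : 0 < a^-1 by rewrite invr_gt0.
  have {h} h : -1 <= a * (x 0 i - c 0 i) <= 1 by apply/andP; split; nra.
  have yE : x 0 i - c 0 i = (a * (x 0 i - c 0 i)) * a^-1 by rewrite mulrAC aV mul1r.
  case/andP: h => h1 h2.
  have l1 : -1 * a^-1 <= x 0 i - c 0 i by rewrite yE ler_wpM2r // ltW.
  have l2 : x 0 i - c 0 i <= 1 * a^-1 by rewrite yE ler_wpM2r // ltW.
  by rewrite in_itv/=; apply/andP; split; lra.
Qed.

(** One axis direction of cutoff_max, at the maximum of rho^2 g - M eta, where
    that function vanishes.  D is eta - 1, and r is the derivative of rho.  The
    first-order condition eliminates g1 and M; the cross term in w1 * r is split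
    by the weighted arithmetic-geometric mean inequality. *)
Lemma cutoff_max_direction (rho g M D s al a w1 w2 r g1 g2 : R) :
  0 < rho -> 0 < g -> 0 < D -> 0 <= s <= 1 -> 0 < al ->
  M * (1 + D) = rho ^+ 2 * g ->
  rho ^+ 2 * g1 + g * (2 * (rho * r)) = M * (- (s * D * w1)) ->
  rho ^+ 2 * g2 + 2 * (2 * (rho * r) * g1) + g * (2 * r ^+ 2 - 4 * a * rho)
    <= M * (D * (s ^+ 2 * w1 ^+ 2 - s * w2)) ->
  g2 + 2 * (w1 * g1) <= g * (D / (1 + D) * (s ^+ 2 * w1 ^+ 2 - s * w2 - 2 * s * w1 ^+ 2)
     + al * w1 ^+ 2 + (4 / al + 6) * (r ^+ 2 / rho ^+ 2) + 4 * a / rho).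
Proof.
move=> rho0 g0 D0 /andP[s0 s1] al0 ME E1 E2.
have [q qE] : {q | q = D / (1 + D)} by exists (D / (1 + D)).
have [y yE] : {y | y = r / rho} by exists (r / rho).
have D1 : 1 + D != 0 by apply: lt0r_neq0; lra.
have rN : rho != 0 by rewrite gt_eqF.
have q0 : 0 <= q by rewrite qE divr_ge0 //; lra.
have q1 : q <= 1 by rewrite qE ler_pdivrMr; lra.
have ryE : r = rho * y by rewrite yE; field.
have MD : M * D = rho ^+ 2 * (g * q).
  have -> : M = rho ^+ 2 * g / (1 + D) by rewrite -ME; field.
  by rewrite qE; field.
have r2 : 0 < rho ^+ 2 by rewrite exprn_gt0.
have g1E : g1 = - (g * (s * q * w1 + 2 * y)).
  apply: (mulfI (lt0r_neq0 r2)).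
  have -> : rho ^+ 2 * g1 = - s * w1 * (M * D) - g * (2 * (rho * r)) by lra.
  by rewrite MD ryE; ring.
have E3 : g2 + 4 * (y * g1) + g * (2 * y ^+ 2 - 4 * a / rho) <=
    g * q * (s ^+ 2 * w1 ^+ 2 - s * w2).
  rewrite -(ler_pM2l r2).
  have -> : rho ^+ 2 * (g * q * (s ^+ 2 * w1 ^+ 2 - s * w2)) =
     M * (D * (s ^+ 2 * w1 ^+ 2 - s * w2)) by rewrite !mulrA MD; ring.
  apply: le_trans E2; rewrite le_eqVlt; apply/orP; left; apply/eqP.
  by rewrite ryE; field.
rewrite -qE.
have -> : r ^+ 2 / rho ^+ 2 = y ^+ 2 by rewrite yE expr_div_n.
have K : - 4 * ((1 - s * q) * (w1 * y)) <= al * w1 ^+ 2 + 4 / al * y ^+ 2.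
  set t := 1 - s * q.
  have t01 : 0 <= t <= 1 by rewrite /t; nra.
  have [v vE] : {v | y = al * v} by exists (y / al); field; rewrite gt_eqF.
  have -> : al * w1 ^+ 2 + 4 / al * y ^+ 2 = al * (w1 ^+ 2 + 4 * v ^+ 2).
    by rewrite vE; field; rewrite gt_eqF.
  have -> : - 4 * (t * (w1 * y)) = al * (t * (- 4 * (w1 * v))) by rewrite vE; ring.
  rewrite ler_pM2l //; case/andP: t01 => t0 t1.
  have h1 := sqr_ge0 (w1 + 2 * v); have h2 := sqr_ge0 (w1 - 2 * v).
  have h3 : 0 <= t * (w1 + 2 * v) ^+ 2 by rewrite mulr_ge0.
  have h4 : 0 <= (1 - t) * (w1 ^+ 2 + 4 * v ^+ 2).
    by rewrite mulr_ge0; [|lra|nra].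
  by nra.
have gK := ler_wpM2l (ltW g0) K.
rewrite g1E in E3 *.
by nra.
Qed.

(** The first- and second-order conditions at a maximum of rho^2 g / eta, where
    rho = 1 - al^2 |x - c|^2, are written for rho^2 g - M eta with M the maximal
    value: this function is globally twice differentiable and has a local
    maximum 0 there.  The errors due to the cutoff are of size al / rho^2, and
    1 / rho^2 <= g / M; so they contribute at most a multiple of al * g^2,
    however close the maximum is to the boundary of the ball. *)
Lemma cutoff_max c w (w1 w2 : 'I_n -> 'rV[R]_n -> R) g
  (g1 g2 : 'I_n -> 'rV[R]_n -> R) (de s al : R) :
  0 < de -> 0 <= s <= 1 -> 0 < al <= 1 ->
  continuous w -> (forall i, jet2 i w (w1 i) (w2 i)) ->
  continuous g -> (forall i, jet2 i g (g1 i) (g2 i)) ->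
  0 < g c ->
  let eta x := 1 + de * expR (- s * w x) in
  let q x := (eta x - 1) / eta x in
  exists x, [/\ al ^+ 2 * sqdist c x <= 1, g c / eta c <= g x &
    \sum_i (g2 i x + 2 * (w1 i x * g1 i x)) <=
    g x * (\sum_i (q x * (s ^+ 2 * w1 i x ^+ 2 - s * w2 i x - 2 * s * w1 i x ^+ 2)
      + al * w1 i x ^+ 2) + (40 + 4 * n%:R) * al * (g x / (g c / eta c)))].
Proof.
move=> de0 s01 /andP[al0 al1] cw jw cg jg gc0 eta q.
pose rho x := 1 - al ^+ 2 * sqdist c x.
have eta1 x : 1 < eta x by rewrite /eta ltrDl mulr_gt0 // expR_gt0.
have eta0 x : 0 < eta x by apply: lt_trans (eta1 x).
pose K := [set x | al ^+ 2 * sqdist c x <= 1].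
have cK : compact K by exact: compact_ball_sqdist.
have Kc : K c by rewrite /K /= sqdistxx mulr0 ler01.
pose F x := rho x ^+ 2 * g x / eta x.
have crho : continuous rho.
  move=> x; apply: (@cvgB _ _ _ (nbhs x)); first exact: cvg_cst.
  by apply: (@cvgM _ _ (nbhs x)); [exact: cvg_cst | exact: continuous_sqdist].
have ceta : continuous eta.
  move=> x; apply: (@cvgD _ _ _ (nbhs x)); first exact: cvg_cst.
  apply: (@cvgM _ _ (nbhs x)); first exact: cvg_cst.
  have h : (fun x => - s * w x) @ nbhs x --> - s * w x.
    by apply: (@cvgM _ _ (nbhs x)); [exact: cvg_cst | exact: cw].
  exact: (cvg_comp _ _ h (@continuous_expR _ _)).
have cF : continuous F.
  move=> x; apply: (@cvgM _ _ (nbhs x)).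
    apply: (@cvgM _ _ (nbhs x)); last exact: cg.
    exact: (cvgM (crho x) (crho x)).
  by apply: (@cvgV _ _ (nbhs x)); [exact: lt0r_neq0 | exact: ceta].
have [x xK xmax] := compact_EVT_max (ex_intro _ c Kc) cK (continuous_subspaceT cF).
have {xK} xK : K x by rewrite inE in xK.
pose M := F x.
have Mc : g c / eta c <= M.
  have := xmax c; rewrite inE => /(_ Kc); apply: le_trans.
  by rewrite /F /rho sqdistxx mulr0 subr0 expr1n mul1r.
have M0 : 0 < M by apply: lt_le_trans Mc; rewrite divr_gt0.
have rle1 y : rho y <= 1 by rewrite /rho gerBl mulr_ge0 ?sqr_ge0 ?sqdist_ge0.
have rho_ge0 : 0 <= rho x by rewrite /rho subr_ge0.
have ME : M * eta x = rho x ^+ 2 * g x by rewrite /M /F divfK // gt_eqF.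
have rho0 : 0 < rho x.
  rewrite lt_neqAle rho_ge0 andbT eq_sym; apply/eqP => r0.
  by move: ME; rewrite r0 expr0n mul0r => /eqP; rewrite mulf_eq0 !gt_eqF.
have gx0 : 0 < g x.
  have : 0 < rho x ^+ 2 * g x by rewrite -ME mulr_gt0.
  by rewrite pmulr_rgt0 // exprn_gt0.
have gM : M <= g x.
  have h1 : M <= M * eta x by rewrite ler_peMr // ltW.
  apply: le_trans h1 _; rewrite ME ler_piMl //; first exact: ltW.
  by rewrite exprn_ile1 // rle1.
exists x; split=> //; first exact: le_trans gM.
pose a := al ^+ 2.
pose r i x : R := - (2 * a) * (x 0 i - c 0 i).
have jrho i : jet2 i rho (r i) (fun=> - (2 * a)).
  apply: jet2_ext (jet2D (jet2_const i 1) (jet2Z (- a) (jet2_sqdist i c))) _ _ _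
    => y //=; rewrite /rho /r /a; ring.
have jeta i : jet2 i eta (fun x => de * (expR (- s * w x) * (- s * w1 i x)))
   (fun x => de * (expR (- s * w x) * ((- s * w1 i x) ^+ 2 + - s * w2 i x))).
  apply: jet2_ext (jet2D (jet2_const i 1) (jet2Z de (jet2_exp (jet2Z (- s) (jw i)))))
     _ _ _ => y //=; by rewrite add0r.
pose H y := rho y * rho y * g y + - M * eta y.
have Hmax : \forall y \near x, H y <= H x.
  have : \forall y \near x, 0 < rho y by apply: (cvgr_gt _ (crho x)).
  apply: filterS => y ry.
  have -> : H x = 0 by rewrite /H -expr2 -ME; ring.
  have : F y <= M.
    apply: xmax; rewrite inE /K /=; move: ry; rewrite /rho; lra.
  rewrite /F ler_pdivrMr // /H; lra.
have jH i := jet2D (jet2M (jet2M (jrho i) (jrho i)) (jg i)) (jet2Z (- M) (jeta i)).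
pose D := de * expR (- s * w x).
have D0 : 0 < D by rewrite mulr_gt0 // expR_gt0.
have etaD : eta x = 1 + D by [].
have per i : g2 i x + 2 * (w1 i x * g1 i x) <=
   g x * (q x * (s ^+ 2 * w1 i x ^+ 2 - s * w2 i x - 2 * s * w1 i x ^+ 2)
     + al * w1 i x ^+ 2 + (4 / al + 6) * (r i x ^+ 2 / rho x ^+ 2) + 4 * a / rho x).
  have [/= E1 E2] := jet2_max (jH i) Hmax.
  have -> : q x = D / (1 + D) by rewrite /q etaD addrC addKr.
  apply: (cutoff_max_direction rho0 gx0 D0 s01 al0 (M := M)) => //.
  - rewrite /D; lra.
  - rewrite /D; lra.
apply: le_trans (ler_sum _ (fun i _ => per i)) _.
rewrite -mulr_sumr; apply: ler_wpM2l; first exact: ltW.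
rewrite [X in X <= _]big_split /= [X in X + _ <= _]big_split /= -addrA lerD2l.
have -> : \sum_i (4 / al + 6) * (r i x ^+ 2 / rho x ^+ 2) =
   (4 / al + 6) * (4 * a * (a * sqdist c x)) / rho x ^+ 2.
  rewrite -mulr_sumr -mulr_suml mulrA; congr (_ * _ / _).
  rewrite /sqdist !mulr_sumr; apply: eq_bigr => i _; rewrite /r; ring.
rewrite sumr_const card_ord -[_ *+ n]mulr_natl.
have rV0 : 0 < (rho x)^-1 by rewrite invr_gt0.
have rV1 : 1 <= (rho x)^-1 by rewrite invf_ge1.
have h1 : (4 / al + 6) * (4 * a * (a * sqdist c x)) / rho x ^+ 2 <=
    40 * al / rho x ^+ 2.
  rewrite ler_pM2r ?invr_gt0 ?exprn_gt0 //.
  have -> : (4 / al + 6) * (4 * a * (a * sqdist c x)) =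
    (16 * al + 24 * a) * (a * sqdist c x) by rewrite /a; field; rewrite gt_eqF.
  have : a <= al by rewrite /a; nra.
  have a0 : 0 < a by rewrite /a exprn_gt0.
  have := xK; rewrite /K /= -/a => xK'; nra.
have h2 : n%:R * (4 * a / rho x) <= 4 * n%:R * al / rho x ^+ 2.
  have -> : n%:R * (4 * a / rho x) = 4 * n%:R * (al * (al * (rho x)^-1)) :> R.
    by rewrite /a; ring.
  rewrite -exprVn -[leRHS]mulrA; apply: ler_wpM2l; first by rewrite mulr_ge0.
  apply: ler_wpM2l; first exact: ltW.
  by rewrite expr2; apply: ler_wpM2r; [exact: ltW | exact: le_trans rV1].
have h3 : (rho x ^+ 2)^-1 <= g x / (g c / eta c).
  have -> : (rho x ^+ 2)^-1 = g x / (M * eta x).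
    by rewrite ME; field; rewrite ?gt_eqF.
  apply: ler_wpM2l; first exact: ltW.
  rewrite lef_pV2 ?posrE; [|exact: mulr_gt0|exact: divr_gt0].
  by apply: le_trans Mc _; rewrite ler_peMr // ltW.
apply: le_trans (lerD h1 h2) _.
rewrite -mulrDl -mulrDl; apply: ler_wpM2l h3.
by rewrite mulr_ge0 ?addr_ge0 ?mulr_ge0 // ltW.
Qed.

End Local.

(** * The approximate maximum principle *)

Section AMP.
Variables (R : realType) (n : nat).
Implicit Types (f g : 'rV[R]_n -> R) (x z c : 'rV[R]_n) (i j : 'I_n).

(** Choice of parameters for approx_max_principle: P, S, w, V, g and q stand for
    |grad w|^2, Delta w, w, V, g and 1 - 1 / eta at the maximum.  Where w < 0, the
    term al * P is absorbed by the negative multiple of q * P; where w >= 0, the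
    equation bounds P by |S| + B.  What is left is quadratic in S with small
    coefficients. *)
Lemma absorb_errors (A e1 eps g q s P S al Cn M m0 w V B q0 cc : R) :
  A - e1 <= g * ((q * (s ^+ 2 * P - s * S - 2 * s * P) + al * P)
                 + Cn * al * (g / M)) ->
  0 <= q <= 1 -> 0 <= s <= 1 -> 0 <= P -> 0 < g -> 0 < m0 <= M ->
  P + S + 2 * w + V = 0 -> - B <= V -> 0 <= B ->
  (w < 0 -> q0 <= q) -> 0 < al <= s * q0 -> 0 <= Cn -> 0 < cc -> 0 < eps ->
  s <= eps / (8 * cc) ->
  al * (1 + B + Cn * (cc / m0)) <= eps / (8 * cc) ->
  g <= cc * (1 + `|S|) -> e1 <= eps / 2 ->
  A <= eps * (1 + S ^+ 2).
Proof.
move=> hA /andP[q_ge0 q1] /andP[s0 s1] P0 g0 /andP[m00 mM] hP hV B0 hq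
  /andP[al0 als] Cn0 cc0 eps0 hs hal hg he1.
set t := `|S|; have t0 : 0 <= t by exact: normr_ge0.
have St : - S <= t by rewrite /t -normrN ler_norm.
have tt : t ^+ 2 = S ^+ 2 by rewrite real_normK ?num_real.
have h1 : q * (s ^+ 2 * P - s * S - 2 * s * P) + al * P <= s * t + al * (t + B).
  have a1 : - (q * s * S) <= s * t.
    have : 0 <= s * q by rewrite mulr_ge0.
    have : s * q * (- S) <= s * q * t by rewrite ler_wpM2l // mulr_ge0.
    have : s * t * q <= s * t by rewrite ler_piMr // mulr_ge0.
    lra.
  have sP : s ^+ 2 * P <= s * P by rewrite ler_wpM2r // expr2 ler_piMr.
  have qsP : q * (s ^+ 2 * P) <= q * (s * P) by rewrite ler_wpM2l.
  have a2 : al * P - q * (s * P) <= al * (t + B).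
    have [w0|w0] := ltP w 0.
      have e : al * P <= s * q0 * P by rewrite ler_wpM2r.
      have e' : q0 * (s * P) <= q * (s * P).
        by rewrite ler_wpM2r ?mulr_ge0 //; exact: hq.
      have : 0 <= al * (t + B) by rewrite mulr_ge0 ?addr_ge0 // ltW.
      lra.
    have e : al * P <= al * (t + B) by apply: ler_wpM2l; [exact: ltW | lra].
    have : 0 <= q * (s * P) by rewrite !mulr_ge0.
    lra.
  lra.
have m1 : m0^-1 > 0 by rewrite invr_gt0.
have h2 : g / M <= cc / m0 * (1 + t).
  have -> : cc / m0 * (1 + t) = cc * (1 + t) / m0 by ring.
  have M0 : 0 < M by apply: lt_le_trans mM.
  apply: ler_pM => //; [exact: ltW | by rewrite invr_ge0 ltW |].
  by rewrite lef_pV2 ?posrE.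
have h3 : Cn * al * (g / M) <= al * (Cn * (cc / m0)) * (1 + t).
  have -> : al * (Cn * (cc / m0)) * (1 + t) = Cn * al * (cc / m0 * (1 + t)) by ring.
  by apply: ler_wpM2l h2; rewrite mulr_ge0 // ltW.
pose k := eps / (8 * cc).
have k0 : 0 < k by rewrite divr_gt0 // mulr_gt0.
have h4 : q * (s ^+ 2 * P - s * S - 2 * s * P) + al * P + Cn * al * (g / M) <=
    2 * k * (1 + t).
  have e1' : s * t <= k * (1 + t).
    have : s * t <= k * t by rewrite ler_wpM2r.
    lra.
  have e2 : al * (1 + B + Cn * (cc / m0)) * (1 + t) <= k * (1 + t).
    by rewrite ler_wpM2r //; lra.
  have e3 : 0 <= al * (B * t) by rewrite !mulr_ge0 // ltW.
  lra.
have h5 : g * (q * (s ^+ 2 * P - s * S - 2 * s * P) + al * P + Cn * al * (g / M))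
    <= cc * (1 + t) * (2 * k * (1 + t)).
  apply: le_trans (ler_wpM2l (ltW g0) h4) _.
  by apply: ler_wpM2r hg; apply: mulr_ge0; [apply: mulr_ge0 (ltW k0) | apply: addr_ge0].
have h6 : cc * (1 + t) * (2 * k * (1 + t)) = eps / 4 * (1 + t) ^+ 2.
  by rewrite /k; field; rewrite gt_eqF.
have h7 : eps / 4 * (1 + t) ^+ 2 <= eps / 4 * (2 * (1 + S ^+ 2)).
  apply: ler_wpM2l; [by apply: divr_ge0 => //; exact: ltW | by rewrite -tt; have := sqr_ge0 (1 - t); rewrite !expr2; lra].
have : 0 <= eps * S ^+ 2 by rewrite mulr_ge0 ?sqr_ge0 // ltW.
lra.
Qed.

(** The inequality that the maximum principle would give at a maximum of G, up to
    a small multiple of 1 + (Delta w)^2.  The point found maximises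
    rho^2 g / eta, where g is G with |grad w|^2 replaced by its approximation. *)
Lemma approx_max_principle w (w1 w2 : 'I_n -> 'rV[R]_n -> R)
  V (V1 : 'I_n -> 'rV[R]_n -> R) W (W1 W2 : 'I_n -> 'rV[R]_n -> R)
  (b B C eps : R) c :
  pureC2 w w1 w2 -> pureC2 W W1 W2 ->
  (forall i x, is_derive x (ebase R i) V (V1 i x)) ->
  (forall i, continuous (V1 i)) ->
  (forall x, \sum_i (w2 i x + w1 i x ^+ 2) + 2 * w x + V x = 0) ->
  1 <= b -> 0 <= B -> (forall x, - B <= V x) ->
  0 <= C -> (forall x, W x - V x <= C) -> 0 < eps ->
  let G x := \sum_i w1 i x ^+ 2 + 2 * b * w x + b * W x in
  0 < G c ->
  exists x, G c - eps <= G x /\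
    \sum_i (2 * w2 i x ^+ 2 - 4 * w1 i x ^+ 2 - 2 * (w1 i x * V1 i x)
      + 2 * b * (w2 i x + 2 * w1 i x ^+ 2)
      + b * (W2 i x + 2 * (w1 i x * W1 i x)))
    <= eps * (1 + (\sum_i w2 i x) ^+ 2).
Proof.
move=> hw hW dV cV1 heq b1 B0 VB C0 WC eps0 G Gc.
have [cw cw1 cw2 jw] := hw; have [cW cW1 cW2 jW] := hW.
pose e1 := Num.min eps (G c).
have e10 : 0 < e1 by rewrite lt_min eps0.
have [e1eps e1G] : e1 <= eps /\ e1 <= G c by rewrite !ge_min !lexx orbT.
pose e2 := Num.min (e1 / 4) 1.
have e20 : 0 < e2 by rewrite lt_min divr_gt0 //=.
have [e2e1 e2_1] : e2 <= e1 / 4 /\ e2 <= 1 by rewrite !ge_min !lexx orbT.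
pose Cn : R := 40 + 4 * n%:R.
have Cn0 : 0 <= Cn by rewrite addr_ge0 // mulr_ge0.
pose cc := b * (1 + C) + 1.
have cc0 : 0 < cc by rewrite ltr_wpDl // mulr_ge0 //; lra.
pose k := eps / (8 * cc).
have k0 : 0 < k by rewrite divr_gt0 // mulr_gt0.
pose s := Num.min 1 k.
have s0 : 0 < s by rewrite lt_min ltr01.
have [s1 sk] : s <= 1 /\ s <= k by rewrite !ge_min !lexx orbT.
(* With this choice eta c = 1 + e1 / (4 G c), so the weight lowers the value
   at the centre by little. *)
pose de := e1 / (4 * G c) * expR (s * w c).
have de0 : 0 < de by rewrite mulr_gt0 ?expR_gt0 // divr_gt0 // mulr_gt0.
(* A positive lower bound for 1 - 1 / eta on the set where w < 0. *)
pose q0 := de / (1 + de).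
have q00 : 0 < q0 by rewrite divr_gt0 // addr_gt0.
pose m0 := G c / 2.
have m00 : 0 < m0 by rewrite divr_gt0.
pose L := 1 + B + Cn * (cc / m0).
have L0 : 0 < L.
  have : 0 <= Cn * (cc / m0) by apply: mulr_ge0 => //; apply: divr_ge0; exact: ltW.
  by rewrite /L; lra.
pose al := Num.min 1 (Num.min (s * q0) (k / L)).
have al0 : 0 < al by rewrite !lt_min ltr01 mulr_gt0 //= divr_gt0.
have [al1 als alL] : [/\ al <= 1, al <= s * q0 & al <= k / L].
  by rewrite !ge_min !lexx !orbT.
have [p [p1 [p2 [cp jp hp]]]] := bochner_approx hw dV cV1 heq
  (@compact_ball_sqdist _ _ c al al0) e20.
pose g x := p x + 2 * b * w x + b * W x.
pose g1 i x := p1 i x + 2 * b * w1 i x + b * W1 i x.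
pose g2 i x := p2 i x + 2 * b * w2 i x + b * W2 i x.
have jg i : jet2 i g (g1 i) (g2 i).
  exact: jet2D (jet2D (jp i) (jet2Z (2 * b) (jw i))) (jet2Z b (jW i)).
have cg : continuous g.
  move=> x; apply: (@cvgD _ _ _ (nbhs x)).
    apply: (@cvgD _ _ _ (nbhs x)); first exact: cp.
    by apply: (@cvgM _ _ (nbhs x)); [exact: cvg_cst | exact: cw].
  by apply: (@cvgM _ _ (nbhs x)); [exact: cvg_cst | exact: cW].
have gG x : al ^+ 2 * sqdist c x <= 1 -> `|g x - G x| <= e2.
  move=> /hp[h _]; rewrite (_ : g x - G x = p x - \sum_i w1 i x ^+ 2) //.
  by rewrite /g /G; ring.
have gc : G c - e2 <= g c.
  have : `|g c - G c| <= e2 by apply: gG; rewrite sqdistxx mulr0.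
  by rewrite ler_norml; lra.
have gc0 : 0 < g c by lra.
have s01 : 0 <= s <= 1 by rewrite ltW.
have al01 : 0 < al <= 1 by rewrite al0.
pose eta x := 1 + de * expR (- s * w x).
pose q x := (eta x - 1) / eta x.
pose M := g c / eta c.
have [x [xK Mg hmax]] : exists x, [/\ al ^+ 2 * sqdist c x <= 1, M <= g x &
    \sum_i (g2 i x + 2 * (w1 i x * g1 i x)) <=
    g x * (\sum_i (q x * (s ^+ 2 * w1 i x ^+ 2 - s * w2 i x - 2 * s * w1 i x ^+ 2)
      + al * w1 i x ^+ 2) + Cn * al * (g x / M))].
  exact: cutoff_max.
have ME : M * (1 + e1 / (4 * G c)) = g c.
  have -> : 1 + e1 / (4 * G c) = eta c.
    rewrite /eta /de -mulrA -expRD mulNr subrr expR0; ring.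
  by rewrite divfK // gt_eqF // /eta addr_gt0 // mulr_gt0 // expR_gt0.
have MG : G c - e1 / 2 <= M.
  have u0 : 0 < 1 + e1 / (4 * G c) by rewrite addr_gt0 // divr_gt0 // mulr_gt0.
  rewrite -(ler_pM2r u0) ME.
  have -> : (G c - e1 / 2) * (1 + e1 / (4 * G c)) = G c - e1 / 4 - e1 ^+ 2 / (8 * G c).
    by field; rewrite gt_eqF.
  have : 0 <= e1 ^+ 2 / (8 * G c) by rewrite divr_ge0 ?sqr_ge0 // mulr_ge0 // ltW.
  lra.
have m0M : m0 <= M by rewrite /m0; lra.
have M0 : 0 < M by apply: lt_le_trans m0M.
have /(_ _ xK) := gG; rewrite ler_norml => /andP[gx1 gx2].
exists x; split; first lra.
have [_ hL] := hp _ xK.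
set A := (X in X <= _).
pose P := \sum_i w1 i x ^+ 2; pose S := \sum_i w2 i x.
have P0 : 0 <= P by apply: sumr_ge0 => i _; exact: sqr_ge0.
have hPS : P + S + 2 * w x + V x = 0.
  by have := heq x; rewrite big_split /= -/P -/S; lra.
have hA : A - e2 <= \sum_i (g2 i x + 2 * (w1 i x * g1 i x)).
  have -> : \sum_i (g2 i x + 2 * (w1 i x * g1 i x)) =
     \sum_i (p2 i x + 2 * (w1 i x * p1 i x)) +
     \sum_i (2 * b * (w2 i x + 2 * w1 i x ^+ 2) + b * (W2 i x + 2 * (w1 i x * W1 i x))).
    rewrite -big_split /=; apply: eq_bigr => i _; rewrite /g1 /g2; ring.
  have -> : A = \sum_i (2 * w2 i x ^+ 2 - 4 * w1 i x ^+ 2 - 2 * (w1 i x * V1 i x)) +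
     \sum_i (2 * b * (w2 i x + 2 * w1 i x ^+ 2) + b * (W2 i x + 2 * (w1 i x * W1 i x))).
    by rewrite -big_split /=; apply: eq_bigr => i _; rewrite addrA.
  lra.
have hR : \sum_i (q x * (s ^+ 2 * w1 i x ^+ 2 - s * w2 i x - 2 * s * w1 i x ^+ 2)
      + al * w1 i x ^+ 2) = q x * (s ^+ 2 * P - s * S - 2 * s * P) + al * P.
  rewrite /P /S !mulr_sumr -!sumrB mulr_sumr -big_split /=.
  by apply: eq_bigr => i _.
have eta1 : 1 < eta x by rewrite /eta ltrDl mulr_gt0 // expR_gt0.
have eta0 : 0 < eta x by apply: lt_trans eta1.
have qx : 0 <= q x <= 1.
  apply/andP; split; first by apply: divr_ge0; [rewrite subr_ge0|]; exact: ltW.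
  by rewrite /q ler_pdivrMr // mul1r gerBl.
have qq0 : w x < 0 -> q0 <= q x.
  move=> w0; have h : de <= eta x - 1.
    rewrite /eta addrC addKr; apply: ler_peMr; first exact: ltW.
    rewrite -expR0 ler_expR mulNr oppr_ge0.
    by apply: mulr_ge0_le0; exact: ltW.
  rewrite /q0 /q ler_pdivrMr ?addr_gt0 // mulrAC ler_pdivlMr //.
  lra.
have gx0 : 0 < g x by apply: lt_le_trans Mg.
apply: (@absorb_errors A e2 eps (g x) (q x) s P S al Cn M m0 (w x) (V x) B q0 cc).
all: rewrite -?hR //.
- by apply: le_trans hA _.
- by rewrite m00.
- by rewrite al0.
- by rewrite -ler_pdivlMr.
- have : 0 <= b * (C - (W x - V x)).
    by rewrite mulr_ge0 //; [lra | have := WC x; lra].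
  have : 0 <= (b - 1) * P by rewrite mulr_ge0 // subr_ge0.
  have t0 : 0 <= `|S| by exact: normr_ge0.
  have St : b * (- S) <= b * `|S|.
    by apply: ler_wpM2l; [lra | rewrite -normrN ler_norm].
  have : 0 <= b * C * `|S| by rewrite !mulr_ge0 //; lra.
  have : g x <= P + b * (2 * w x) + b * W x + e2.
    by move: gx2; rewrite /G -/P; lra.
  have -> : 2 * w x = - P - S - V x by lra.
  rewrite /cc; lra.
- lra.
Qed.

End AMP.

(** * Functions with continuous partial derivatives *)

Section Chain.
Variables (R : realType) (n : nat).
Implicit Types (f g : 'rV[R]_n -> R) (x z c v : 'rV[R]_n) (i j : 'I_n).

Lemma line_mvt_signed (U : normedModType R) (f df : U -> R) (x v : U) (t : R) :
  (forall y, is_derive y v f (df y)) ->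
  exists2 c, `|c| <= `|t| & f (t *: v + x) - f x = df (c *: v + x) * t.
Proof.
move=> fd; have [t0|t0] := leP 0 t.
  have [c /andP[c0 ct] E] := line_mvt x t0 fd.
  by exists c => //; rewrite !ger0_norm.
have t0' : 0 <= - t by rewrite oppr_ge0 ltW.
have [c /andP[c0 ct] E] := line_mvt (t *: v + x) t0' fd.
exists (c + t); first by rewrite (ltr0_norm t0) ler0_norm; lra.
rewrite scalerDl -addrA.
by move: E; rewrite scaleNr addKr; lra.
Qed.

(** The increment along v is the sum of increments along the axes, each of which
    the mean value theorem expresses by a partial derivative at a nearby point. *)
Lemma is_derive_partials f (f1 : 'I_n -> 'rV[R]_n -> R) x v :
  (forall i y, is_derive y (ebase R i) f (f1 i y)) ->
  (forall i, continuous (f1 i)) ->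
  is_derive x v f (\sum_i v 0 i * f1 i x).
Proof.
move=> df cf1.
(* The first k coordinates of v: a path from 0 to v with steps along the axes. *)
pose vk k : 'rV[R]_n := \row_i (if (i < k)%N then v 0 i else 0).
have vkS i : vk i.+1 = v 0 i *: ebase R i + vk i.
  apply/rowP => j; rewrite !mxE eqxx /=; have [->|ji] := eqVneq j i.
    by rewrite ltnSn ltnn mulr1 addr0.
  by rewrite ltnS leq_eqVlt (negPf ji : (j == i :> nat) = false) mulr0 add0r.
have vk0 : vk 0%N = 0 by apply/rowP => j; rewrite !mxE.
have vkn : vk n = v by apply/rowP => j; rewrite !mxE ltn_ord.
have step i : (fun t : R => t^-1 * (f (t *: vk i.+1 + x) - f (t *: vk i + x)))
     @ (0 : R)^' --> v 0 i * f1 i x.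
  apply/cvgrPdist_lt => e e0.
  have a0 : 0 < `|v 0 i| + 1 by rewrite ltr_wpDl.
  have ct : (fun z : R * R => z.1 *: ebase R i + (z.2 *: vk i + x)) @
      filter_prod (nbhs (0 : R)) (nbhs (0 : R)) --> x.
    have : (fun z : R * R => z.1 *: ebase R i + (z.2 *: vk i + x)) @
      filter_prod (nbhs (0 : R)) (nbhs (0 : R)) --> 0 *: ebase R i + (0 *: vk i + x).
      apply: cvgD; first by apply: cvgZr_tmp; exact: cvg_fst.
      by apply: cvgD; [apply: cvgZr_tmp; exact: cvg_snd | exact: cvg_cst].
    by rewrite !scale0r !add0r.
  have := cvg_comp _ _ ct (cf1 i x).
  move=> /cvgrPdist_lt /(_ (e / (`|v 0 i| + 1))); rewrite divr_gt0 // => /(_ isT).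
  move=> [[A B] /= [A0 B0] AB].
  have [d /= d0 Ad] := (nbhs_ballP _ _).1 A0.
  have Bn : \forall t \near (0 : R)^', B t by exact: nbhs_dnbhs.
  have dn : \forall t \near (0 : R)^', `|t| < d / (`|v 0 i| + 1).
    by apply: dnbhs0_lt; rewrite divr_gt0.
  have n0 : \forall t \near (0 : R)^', t != 0 by exact: nbhs_dnbhs_neq.
  near=> t.
  have t0 : t != 0 by near: t.
  have Bt : B t by near: t.
  have td : `|t| < d / (`|v 0 i| + 1) by near: t.
  rewrite vkS scalerDr scalerA -addrA.
  have [c ct' ->] := line_mvt_signed (t *: vk i + x) (t * v 0 i) (df i).
  rewrite [X in `|_ - X|](_ : _ = v 0 i * f1 i (c *: ebase R i + (t *: vk i + x))); last first.
    by field.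
  rewrite -mulrBr normrM.
  have cA : A c.
    apply: Ad; rewrite /ball/= sub0r normrN; apply: le_lt_trans ct' _.
    move: td; rewrite ltr_pdivlMr // normrM => td; have := normr_ge0 t; lra.
  have := AB (c, t) (conj cA Bt); rewrite /= ltr_pdivlMr // => h.
  apply: le_lt_trans h; rewrite mulrC ler_wpM2l ?normr_ge0 //; lra.
have tot : (fun t : R => t^-1 * (f (t *: v + x) - f x)) @ (0 : R)^' -->
    \sum_i v 0 i * f1 i x.
  have -> : (fun t : R => t^-1 * (f (t *: v + x) - f x)) =
      (fun t => \sum_(i < n) t^-1 * (f (t *: vk i.+1 + x) - f (t *: vk i + x))).
    apply/funext => t; rewrite -mulr_sumr.
    rewrite -(big_mkord xpredT (fun k => f (t *: vk k.+1 + x) - f (t *: vk k + x))).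
    by rewrite (telescope_sumr (fun k => f (t *: vk k + x))) // vkn vk0 scaler0 add0r.
  exact: (cvg_sumR step).
by split; [exact: cvgP tot | apply: cvg_lim tot].
Unshelve. all: by end_near. Qed.

(** The constants 3/2 and 1/6 come from v a <= 3/2 a^2 + v^2 / 6, applied in each
    coordinate.  The coefficient 1/6 has to be below the 1/4 of the quadratic
    function used in log_bound_gradient. *)
Lemma segment_increment_le f (f1 : 'I_n -> 'rV[R]_n -> R) (G2 : R) x c :
  (forall i y, is_derive y (ebase R i) f (f1 i y)) ->
  (forall i, continuous (f1 i)) ->
  (forall y, \sum_i f1 i y ^+ 2 <= G2) ->
  f c - f x <= 3 / 2 * G2 + sqdist c x / 6.
Proof.
move=> df cf1 hG.
have [y _] := line_mvt x ler01 (fun y => is_derive_partials y (c - x) df cf1).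
rewrite scale1r subrK mulr1 => ->.
apply: le_trans (_ : 3 / 2 * \sum_i f1 i (y *: (c - x) + x) ^+ 2 + sqdist c x / 6 <= _).
  rewrite /sqdist mulr_sumr mulr_suml -big_split /=; apply: ler_sum => i _.
  rewrite !mxE; set a := f1 _ _.
  have := sqr_ge0 (3 * a - (c 0 i - x 0 i)); rewrite !expr2; lra.
by rewrite lerD2r ler_wpM2l // divr_ge0.
Qed.

End Chain.

Section Sums.
Variables (R : realType) (n : nat).

Lemma sqr_sum_le (a : 'I_n -> R) : (\sum_i a i) ^+ 2 <= n%:R * \sum_i a i ^+ 2.
Proof.
case: n a => [|m] a; first by rewrite !big_ord0 expr0n mulr0.
set S := \sum_i a i; set N : R := m.+1%:R.
have N0 : 0 < N by rewrite ltr0n.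
have : 0 <= \sum_i (a i - S / N) ^+ 2 by apply: sumr_ge0 => i _; exact: sqr_ge0.
have -> : \sum_i (a i - S / N) ^+ 2 = \sum_i a i ^+ 2 - S ^+ 2 / N.
  have -> : \sum_i (a i - S / N) ^+ 2 =
    \sum_i (a i ^+ 2 - 2 * (S / N) * a i + (S / N) ^+ 2).
    by apply: eq_bigr => i _; ring.
  rewrite big_split /= sumrB -mulr_sumr -/S sumr_const card_ord -[_ *+ _]mulr_natl -/N.
  by field; rewrite gt_eqF.
by rewrite subr_ge0 ler_pdivrMr // mulrC.
Qed.
End Sums.

(** * Upper bounds for w *)

Section Bounds.
Variables (R : realType) (n : nat).
Implicit Types (x c : 'rV[R]_n) (i j : 'I_n).

Variables (w : 'rV[R]_n -> R) (w1 w2 : 'I_n -> 'rV[R]_n -> R).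
Variables (V : 'rV[R]_n -> R) (V1 V2 : 'I_n -> 'rV[R]_n -> R).
Hypothesis n0 : (0 < n)%N.
Hypothesis hw : pureC2 w w1 w2.
Hypothesis hV : pureC2 V V1 V2.
Hypothesis heq : forall x, \sum_i (w2 i x + w1 i x ^+ 2) + 2 * w x + V x = 0.

Let n1 : 1 <= n%:R :> R. Proof. by rewrite ler1n. Qed.
Let nV0 : 0 < n%:R^-1 :> R. Proof. by rewrite invr_gt0 ltr0n. Qed.
Let nVn : n%:R^-1 * n%:R = 1 :> R.
Proof. by rewrite mulVf // gt_eqF // ltr0n. Qed.
Let nV1 : n%:R^-1 <= 1 :> R. Proof. by rewrite invf_le1 ?ltr0n. Qed.
Let dV i x : is_derive x (ebase R i) V (V1 i x).
Proof. by have [_ _ _ /(_ i)[]] := hV. Qed.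

Let sum_heq x : \sum_i w1 i x ^+ 2 + \sum_i w2 i x + 2 * w x + V x = 0.
Proof. by have := heq x; rewrite big_split /=; lra. Qed.

(** If w c were larger, then K >= 4 n + 2 D at c.  The point given by
    approx_max_principle for the error 1 / n has K >= 4 n + 2 D - 1 / n and
    K^2 / n <= 2 K + D + 1 / n, which is impossible. *)
Lemma log_bound_laplacian (B D : R) : (forall x, `|V x| <= B) ->
  (forall x, `|\sum_i V2 i x| <= D) ->
  forall c, w c <= 2 * n%:R + D + 2 * B.
Proof.
have n1' := n1; have nV1' := nV1.
move=> VB VD c; rewrite leNgt; apply/negP => hc.
have VB' x : - B <= V x <= B by rewrite -ler_norml.
have VD' x : - D <= \sum_i V2 i x <= D by rewrite -ler_norml.
have B0 : 0 <= B by apply: le_trans (VB c).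
have D0 : 0 <= D by apply: le_trans (VD c).
pose G x := \sum_i w1 i x ^+ 2 + 2 * 1 * w x + 1 * V x.
have P0 x : 0 <= \sum_i w1 i x ^+ 2 by apply: sumr_ge0 => i _; exact: sqr_ge0.
have Gc : 4 * n%:R + 2 * D <= G c.
  by have := VB' c; have := P0 c; rewrite /G; lra.
have VV x : V x - V x <= 0 by rewrite subrr.
have cV1 i : continuous (V1 i) by have [_ h _ _] := hV.
have Gc0 : 0 < G c by lra.
have [x [Gx Ax]] := @approx_max_principle _ _ _ _ _ _ V1 _ _ _ 1 B 0 n%:R^-1 c hw hV dV
   cV1 heq (lexx 1) B0 (fun x => proj1 (andP (VB' x))) (lexx 0) VV nV0 Gc0.
set K := - \sum_i w2 i x.
have KG : K = G x by have := sum_heq x; rewrite /K /G; lra.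
have {}Gx : 4 * n%:R + 2 * D - 1 <= K by rewrite KG; move: Gx; rewrite -/(G x) -/(G c); lra.
have hA : 2 * (n%:R^-1 * K ^+ 2) - 2 * K - D <= n%:R^-1 * (1 + K ^+ 2).
  rewrite [X in 1 + X](_ : _ = (\sum_i w2 i x) ^+ 2) ?sqrrN //.
  apply: le_trans Ax.
  have -> : \sum_i (2 * w2 i x ^+ 2 - 4 * w1 i x ^+ 2 - 2 * (w1 i x * V1 i x) +
      2 * 1 * (w2 i x + 2 * w1 i x ^+ 2) + 1 * (V2 i x + 2 * (w1 i x * V1 i x)))
    = 2 * \sum_i w2 i x ^+ 2 + 2 * \sum_i w2 i x + \sum_i V2 i x.
    by rewrite !mulr_sumr -!big_split /=; apply: eq_bigr => i _; ring.
  have : n%:R^-1 * K ^+ 2 <= \sum_i w2 i x ^+ 2.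
    rewrite mulrC ler_pdivrMr ?ltr0n // [leRHS]mulrC sqrrN; exact: sqr_sum_le.
  have := VD' x; rewrite /K; lra.
have K3 : 3 * n%:R <= K by lra.
have : 0 <= n%:R^-1 * (K * (K - 3 * n%:R)).
  by rewrite !mulr_ge0 ?subr_ge0 ?(ltW nV0) //; lra.
have -> : n%:R^-1 * (K * (K - 3 * n%:R)) = n%:R^-1 * K ^+ 2 - 3 * (n%:R^-1 * n%:R) * K.
  by ring.
rewrite nVn; lra.
Qed.

(** Let r = |x - c| at the point x given by approx_max_principle for the error
    1 / n.  There K^2 / n <= 4 K + n + G2 / 2 + r^2 / 2 + 1 / n.  If w c
    were larger, then K >= 32/3 n + 5/18 G2 + r^2 / 12 - 1/2: the quadratic part
    of W makes K grow with r, and K >= 10 n turns K^2 / n into 10 K, which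
    outweighs the right-hand side. *)
Lemma log_bound_gradient (B G2 : R) : (forall x, `|V x| <= B) ->
  (forall x, \sum_i V1 i x ^+ 2 <= G2) ->
  forall c, w c <= 3^-1 * (16 * n%:R + 8 * B + 8 / 3 * G2 - 8 * V c).
Proof.
have n1' := n1; have nV1' := nV1.
move=> VB VG c; rewrite leNgt; apply/negP => hc.
have VB' x : - B <= V x <= B by rewrite -ler_norml.
have B0 : 0 <= B by apply: le_trans (VB c).
have P0 x : 0 <= \sum_i w1 i x ^+ 2 by apply: sumr_ge0 => i _; exact: sqr_ge0.
have G20 : 0 <= G2.
  by apply: le_trans (VG c); apply: sumr_ge0 => i _; exact: sqr_ge0.
have cV1 i : continuous (V1 i) by have [_ h _ _] := hV.
pose W x := V c + - 4^-1 * sqdist c x.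
pose W1 i x : R := - 2^-1 * (x 0 i - c 0 i).
have hW : pureC2 W W1 (fun _ _ => - 2^-1).
  split=> [x|i x|i x|i].
  - apply: (@cvgD _ _ _ (nbhs x)); first exact: cvg_cst.
    by apply: (@cvgM _ _ (nbhs x)); [exact: cvg_cst | exact: continuous_sqdist].
  - apply: (@cvgM _ _ (nbhs x)); first exact: cvg_cst.
    by apply: (@cvgB _ _ _ (nbhs x)); [exact: coord_continuous | exact: cvg_cst].
  - exact: cst_continuous.
  - apply: jet2_ext (jet2D (jet2_const i (V c)) (jet2Z (- 4^-1) (jet2_sqdist i c))) _ _ _
      => x //=; rewrite /W1; lra.
pose G x := \sum_i w1 i x ^+ 2 + 2 * 2 * w x + 2 * W x.
have Gc : 64 / 3 * n%:R + 32 / 9 * G2 <= G c.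
  rewrite /G /W sqdistxx; have := P0 c; have := VB' c; lra.
have Gc0 : 0 < G c by lra.
have WV x : W x - V x <= 2 * B.
  by rewrite /W; have := VB' c; have := VB' x; have := sqdist_ge0 c x; lra.
have B20 : 0 <= 2 * B by lra.
have b2 : 1 <= 2 :> R by lra.
have [x [Gx Ax]] := @approx_max_principle _ _ _ _ _ _ V1 _ _ _ 2 B (2 * B) n%:R^-1 c hw hW dV
   cV1 heq b2 B0 (fun x => proj1 (andP (VB' x))) B20 WV nV0 Gc0.
set K := - \sum_i w2 i x.
have r0 := sqdist_ge0 c x.
have KG : 32 / 3 * n%:R + 5 / 18 * G2 + sqdist c x / 12 - 1 / 2 <= K.
  have GE : G x = \sum_i w1 i x ^+ 2 + 4 * w x + 2 * V c - sqdist c x / 2.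
    by rewrite /G /W; lra.
  have h1 := segment_increment_le x c dV cV1 VG.
  have h2 := sum_heq x; have h3 := P0 x.
  have h4 : G c - n%:R^-1 <= G x := Gx.
  by rewrite /K; lra.
have hA : 2 * (n%:R^-1 * K ^+ 2) - 4 * K - n%:R - G2 / 2 - sqdist c x / 2
    <= n%:R^-1 * (1 + K ^+ 2).
  rewrite [X in 1 + X](_ : _ = (\sum_i w2 i x) ^+ 2) ?sqrrN //.
  apply: le_trans Ax.
  have h1 : 2 * \sum_i w2 i x ^+ 2 + 4 * \sum_i w2 i x - n%:R -
    2^-1 * \sum_i V1 i x ^+ 2 - 2^-1 * sqdist c x <=
    \sum_i (2 * w2 i x ^+ 2 - 4 * w1 i x ^+ 2 - 2 * (w1 i x * V1 i x) +
      2 * 2 * (w2 i x + 2 * w1 i x ^+ 2) + 2 * (- 2^-1 + 2 * (w1 i x * W1 i x))).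
    have -> : n%:R = \sum_(i < n) 1 :> R by rewrite sumr_const card_ord.
    rewrite /sqdist !mulr_sumr -!big_split /= -!sumrB; apply: ler_sum => i _.
    rewrite /W1; set a := w1 i x; set d := V1 i x; set y := x 0 i - c 0 i.
    (* completing the square in a, then (y + d)^2 <= 2 y^2 + 2 d^2 *)
    have := sqr_ge0 (2 * a - 2^-1 * y - 2^-1 * d).
    have := sqr_ge0 (y - d).
    by rewrite !expr2; lra.
  apply: le_trans h1.
  have : n%:R^-1 * K ^+ 2 <= \sum_i w2 i x ^+ 2.
    rewrite mulrC ler_pdivrMr ?ltr0n // [leRHS]mulrC sqrrN; exact: sqr_sum_le.
  have := VG x; rewrite /K; lra.
have K3 : 10 * n%:R <= K by lra.
have : 0 <= n%:R^-1 * (K * (K - 10 * n%:R)).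
  by rewrite !mulr_ge0 ?subr_ge0 ?(ltW nV0) //; lra.
have -> : n%:R^-1 * (K * (K - 10 * n%:R)) = n%:R^-1 * K ^+ 2 - 10 * (n%:R^-1 * n%:R) * K.
  by ring.
rewrite nVn; lra.
Qed.

End Bounds.

(** * From the solution to its logarithm *)

Section Assembly.
Variables (R : realType) (n : nat).
Implicit Types (f V u : 'rV[R]_n -> R).

Lemma C2_pureC2 f : C2 f -> pureC2 f (fun i => partial i f) (fun i => partial i (partial i f)).
Proof.
move=> hf; have [[cf cf1] cf2] := hf; split=> // i; first by have [] := cf1 i.
  by have [_ /(_ i)[]] := cf2 i.
exact: jet2_C2.
Qed.

Lemma pureC2_ln f (f1 f2 : 'I_n -> 'rV[R]_n -> R) : (forall x, 0 < f x) ->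
  pureC2 f f1 f2 ->
  pureC2 (fun x => ln (f x)) (fun i x => (f x)^-1 * f1 i x)
    (fun i x => (f x)^-1 * f2 i x - ((f x)^-1 * f1 i x) ^+ 2).
Proof.
move=> f0 [cf cf1 cf2 jf].
have cV x : (fun y => (f y)^-1) @ nbhs x --> (f x)^-1.
  by apply: (@cvgV _ _ (nbhs x)); [exact: lt0r_neq0 | exact: cf].
have c1 i x : (fun y => (f y)^-1 * f1 i y) @ nbhs x --> (f x)^-1 * f1 i x.
  by apply: (@cvgM _ _ (nbhs x)); [exact: cV | exact: cf1].
split=> [x|i x|i x|i]; first exact: (cvg_comp _ _ (cf x) (continuous_ln (f0 x))).
- exact: c1.
- apply: (@cvgB _ _ _ (nbhs x)).
    by apply: (@cvgM _ _ (nbhs x)); [exact: cV | exact: cf2].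
  exact: (cvgM (c1 i x) (c1 i x)).
- exact: jet2_ln.
Qed.

Lemma le_supR f (M : R) x : (forall y, f y <= M) -> f x <= supR f.
Proof.
move=> fM; apply: ub_le_sup; [by exists M => _ [y _ <-] | by exists x].
Qed.

Lemma bounded_funE f : bounded_fun f <-> exists M, forall x, `|f x| <= M.
Proof.
split=> [/pinfty_ex_gt0 [M _ hM]|[M h]]; first by exists M => x; exact: hM.
have : \forall k \near +oo, M <= k by apply: nbhs_pinfty_ge; exact: num_real.
by apply: filterS => k Mk x _; exact: le_trans (h x) Mk.
Qed.

Lemma sqr_enorm_grad f x : enorm (grad f x) ^+ 2 = \sum_i partial i f x ^+ 2.
Proof.
rewrite /enorm sqr_sqrtr; last by apply: sumr_ge0 => i _; exact: sqr_ge0.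
by apply: eq_bigr => i _; rewrite mxE.
Qed.

Lemma enorm_ge0 (v : 'rV[R]_n) : 0 <= enorm v.
Proof. exact: sqrtr_ge0. Qed.

Lemma log_equation V u : is_positive_solution V u -> forall x,
  \sum_i ((u x)^-1 * partial i (partial i u) x - ((u x)^-1 * partial i u x) ^+ 2
    + ((u x)^-1 * partial i u x) ^+ 2) + 2 * ln (u x) + V x = 0.
Proof.
move=> [_ u0 hu] x.
have ux : u x != 0 by rewrite gt_eqF.
have -> : \sum_i ((u x)^-1 * partial i (partial i u) x - ((u x)^-1 * partial i u x) ^+ 2
    + ((u x)^-1 * partial i u x) ^+ 2) = (u x)^-1 * laplacian u x.
  by rewrite /laplacian mulr_sumr; apply: eq_bigr => i _; rewrite subrK.
apply: (mulfI ux); rewrite mulr0 -(hu x); by field.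
Qed.

End Assembly.

Unset Implicit Arguments.
Set Strict Implicit.
Set Printing Implicit Defensive.

Theorem theorem1p3 (R : realType) (n : nat) (hn : (0 < n)%N)
    (V u : 'rV[R]_n -> R) (hV : C2 V) (hu : is_positive_solution V u) :
  [/\ bounded_fun V -> bounded_fun (fun x => enorm (grad V x)) ->
        bounded_fun u /\ (forall x, u x <= bound1 V x),
      (forall c, 0 <= c -> (forall y, V y = c) ->
        forall x, bound1 V x = expR (3^-1 * (16 * n%:R)))
    & bounded_fun V -> bounded_fun (laplacian V) ->
        bounded_fun (fun x => enorm (grad V x)) ->
        bounded_fun u /\ (forall x, u x <= bound2 V)].
Proof.
have [hu2 u0 _] := hu.
have hw := pureC2_ln u0 (C2_pureC2 hu2).
have hV2 := C2_pureC2 hV.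
have heq := log_equation hu.
have uexp x : u x = expR (ln (u x)) by rewrite lnK // posrE.
have ubounded (M : R) : (forall x, u x <= M) -> bounded_fun u.
  by move=> hM; apply/bounded_funE; exists M => x; rewrite gtr0_norm.
have supV (B : R) : (forall x, `|V x| <= B) ->
    forall x, `|V x| <= supR (fun y => `|V y|).
  by move=> hB x; apply: (@le_supR _ _ (fun y => `|V y|) B).
split.
- move=> /bounded_funE [B hB] /bounded_funE [g hg].
  have hG x : \sum_i partial i V x ^+ 2 <= supR (fun y => enorm (grad V y) ^+ 2).
    rewrite -sqr_enorm_grad.
    apply: (@le_supR _ _ (fun y => enorm (grad V y) ^+ 2) (g ^+ 2)) => y.
    by apply: lerXn2r; rewrite ?nnegrE ?enorm_ge0 //; have := hg y;
      rewrite ger0_norm ?enorm_ge0 // => h; apply: le_trans h; exact: enorm_ge0.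
  have ub x : u x <= bound1 V x.
    rewrite uexp /bound1 ler_expR.
    exact: log_bound_gradient hn hw hV2 heq _ _ (supV _ hB) hG x.
  split=> //.
  apply: (ubounded (expR (3^-1 * (16 * n%:R + 8 * supR (fun y => `|V y|)
     + 8 / 3 * supR (fun y => enorm (grad V y) ^+ 2) + 8 * B)))) => x.
  apply: le_trans (ub x) _; rewrite /bound1 ler_expR.
  have := hB x; rewrite ler_norml => /andP[h _]; lra.
- move=> c c0 hc x; rewrite /bound1 hc.
  have supc (f : 'rV[R]_n -> R) (k : R) : (forall y, f y = k) -> supR f = k.
    move=> fk; rewrite /supR (_ : range f = [set k]) ?sup1 //.
    by apply/seteqP; split=> [_ [y _ <-] | _ ->]; [exact: fk | exists x].
  rewrite (supc _ c); last by move=> y; rewrite hc ger0_norm.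
  rewrite (supc _ 0); last first.
    move=> y; rewrite sqr_enorm_grad big1 // => i _.
    have -> : V = cst c by apply/funext.
    by rewrite /partial derive_cst expr0n.
  by congr expR; ring.
- move=> /bounded_funE [B hB] /bounded_funE [D hD] /bounded_funE [g hg].
  have hD' x : `|\sum_i partial i (partial i V) x| <= supR (fun y => `|laplacian V y|).
    exact: (@le_supR _ _ (fun y => `|laplacian V y|) D).
  have g0 : 0 <= supR (fun y => enorm (grad V y)).
    apply: le_trans (enorm_ge0 (grad V 0)) _.
    apply: (@le_supR _ _ (fun y => enorm (grad V y)) g) => y.
    exact: le_trans (ler_norm _) (hg y).
  have ub x : u x <= bound2 V.
    rewrite uexp /bound2 ler_expR.
    apply: le_trans (log_bound_laplacian hn hw hV2 heq (supV _ hB) hD' x) _.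
    lra.
  by split=> //; exact: ubounded ub.
Qed.
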